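(* Consider an eigenvalue minimization problem with data $(f,\mathfrak{g},\mathfrak{h})$ and correlative sparsity given by cliques $I_1,\dots,I_p\subseteq\{1,\dots,n\}$ and partitions $(J_j)_{j=1}^p$ of $\{1,\dots,m\}$ and $(W_j)_{j=1}^p$ of $\{1,\dots,\ell\}$. Assume that there is a noncommutative ball constraint on each clique of variables, i.e. $1-\sum_{i\in I_j}X_i^2\in\mathfrak{g}_{J_j}$ for every $j=1,\dots,p$. Then $\mathbb{R}^{>0}\subseteq Q_k^\circ(\mathfrak{g}_{J_j})$ for all integers $k\ge k_{\min}$ and all $j=1,\dots,p$ (every positive real constant belongs to $Q_k^\circ(\mathfrak{g}_{J_j})$). As a consequence, the problem has the constant trace property for correlative sparsity (CS-CTP).
   Context: $\mathbb{R}\langle\underline{X}\rangle$ is the free algebra of polynomials in noncommuting letters $\underline{X}=(X_1,\dots,X_n)$, with the involution $*$ fixing $\mathbb{R}$ and each $X_i$ and reversing words; $\mathrm{Sym}\,\mathbb{R}\langle\underline{X}\rangle$ is the set of $p$ with $p^*=p$. For $I\subseteq\{1,\dots,n\}$, $\underline{X}(I)=\{X_i:i\in I\}$, and $\mathbf{W}_d^I$ denotes both the set of words of length at most $d$ (including the empty word $1$) using only letters in $\underline{X}(I)$ and the column vector of these words, of length $\mathbf{s}(d,|I|)=\sum_{i=0}^d|I|^i$; $\mathbf{W}_d$ is the case $I=\{1,\dots,n\}$; $(\mathbf{W}_d^I)^*$ is the row vector with entries $w^*$. For a polynomial $q$, $\lceil q\rceil:=\lceil\deg(q)/2\rceil$,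 $k_q:=k-\lceil q\rceil$. Data: $f\in\mathrm{Sym}\,\mathbb{R}\langle\underline{X}\rangle$, $\mathfrak{g}=\{g_0=1,g_1,\dots,g_m\}$ and $\mathfrak{h}=\{h_1,\dots,h_\ell\}$ finite subsets of $\mathrm{Sym}\,\mathbb{R}\langle\underline{X}\rangle$; the eigenvalue problem is to minimize $\mathbf{v}^*f(\underline{A})\mathbf{v}$ over unit vectors $\mathbf{v}$ and tuples $\underline{A}$ of bounded self-adjoint operators with $g(\underline{A})\succeq0$ ($g\in\mathfrak{g}$), $h(\underline{A})=0$ ($h\in\mathfrak{h}$). $k_{\min}:=\max\{\lceil f\rceil,\lceil g_i\rceil,\lceil h_j\rceil:1\le i\le m,1\le j\le\ell\}$. Correlative sparsity: $I_1,\dots,I_p$ (with $n_j=|I_j|$) are the maximal cliques of (a chordal extension of) the correlative sparsity pattern graph, whose vertices are $1,\dots,n$ and in which two indices are adjacent when the corresponding letters occur in a common word of $f$ or in a common constraint polynomial. $(J_j)_{j=1}^p$ is a partition of $\{1,\dots,m\}$ and $(W_j)_{j=1}^p$ a partition of $\{1,\dots,\ell\}$ with $g_i\in\mathbb{R}\langle\underline{X}(I_j)\rangle$ for $i\in J_j$ and $h_i\in\mathbb{R}\langle\underline{X}(I_j)\rangle$ for $i\in W_j$. $\mathfrak{g}_{J_j}=\{g_i:i\in J_j\}$. $$Q_k^\circ(\mathfrak{g}_{J_j}):=\Big\{\sum_{i\in\{0\}\cup J_j}\mathrm{Tr}\big(\mathbf{G}_i\mathbf{W}^{I_j}_{k_{g_i}}g_i(\mathbf{W}^{I_j}_{k_{g_i}})^*\big):\mathbf{G}_i\succ0\Big\},$$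 with $\mathbf{G}_i$ real symmetric positive definite of size $\mathbf{s}(k_{g_i},n_j)$; here $\mathrm{Tr}(\mathbf{G}\mathbf{W}\,g\,\mathbf{W}^* )=\sum_{u,v}\mathbf{G}_{u,v}\,v\,g\,u^*$. For real $\mathbf{y}=(y_w)_{w\in\mathbf{W}_{2k}}$ with $y_w=y_{w^*}$, $L_{\mathbf{y}}(\sum_wq_ww)=\sum_wq_wy_w$; $\mathbf{M}_k(\mathbf{y},I)$ has entries $L_{\mathbf{y}}(u^*v)$, $u,v\in\mathbf{W}_k^I$; for symmetric $q\in\mathbb{R}\langle\underline{X}(I)\rangle$, $\mathbf{M}_{k_q}(q\mathbf{y},I)$ has entries $L_{\mathbf{y}}(u^*qv)$, $u,v\in\mathbf{W}_{k_q}^I$. $\mathbf{D}_k(\mathbf{y},I_j):=\mathrm{diag}(\mathbf{M}_k(\mathbf{y},I_j),(\mathbf{M}_{k_{g_i}}(g_i\mathbf{y},I_j))_{i\in J_j})$. $\mathcal{S}^{(k,j)}$ is the set of block diagonal real symmetric matrices $\mathrm{diag}(\mathbf{Y}_0,(\mathbf{Y}_i)_{i\in J_j})$ with $\mathbf{Y}_0$ of size $\mathbf{s}(k,n_j)$ and $\mathbf{Y}_i$ of size $\mathbf{s}(k_{g_i},n_j)$; $\mathcal{S}^{(k,j)}_{++}$ is the set of its positive definite elements. CS-CTP: for every integer $k\ge k_{\min}$ and every $j=1,\dots,p$ there exist $a_k^{(j)}>0$ and $\mathbf{P}_k^{(j)}\in\mathcal{S}^{(k,j)}_{++}$ such that for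 all $\mathbf{y}$ indexed by $\mathbf{W}_{2k}$ with $y_w=y_{w^*}$: if $\mathbf{M}_{k_{h_i}}(h_i\mathbf{y},I_j)=0$ for all $i\in W_j$ and $y_1=1$, then $\mathrm{Tr}(\mathbf{P}_k^{(j)}\mathbf{D}_k(\mathbf{y},I_j)\mathbf{P}_k^{(j)})=a_k^{(j)}$. *)

(* Defs.v *)
From HB Require Import structures.
From mathcomp Require Import all_boot all_order all_algebra.
From mathcomp Require Import finmap.
From mathcomp Require Import reals.
From mathcomp.multinomials Require Import monalg.

Set Implicit Arguments.
Unset Strict Implicit.
Unset Printing Implicit Defensive.

Import Order.TTheory GRing.Theory Num.Theory.
Local Open Scope ring_scope.

(* Words in X_1, ..., X_n, and the free algebra R<X> as their monoid algebra. *)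
Notation word n := {fmonom 'I_n}.
Notation ncpoly R n := {malg R[{fmonom 'I_n}]}.

Section Polynomials.
Variables (R : realType) (n : nat).
Implicit Types (q : ncpoly R n) (w : word n) (I : {set 'I_n}).

Definition letter (i : 'I_n) : ncpoly R n := << fmu i >>.

Definition wstar w : word n := FMonom (rev w).

Definition pstar q : ncpoly R n :=
  \sum_(w <- msupp q) << q@_w *g wstar w >>.

Definition ncsym q : Prop := pstar q = q.

(* The degree of the zero polynomial is 0 here. *)
Definition ncdeg q : nat := \max_(w <- msupp q) fdeg w.

Definition hdeg q : nat := uphalf (ncdeg q).

Definition nvars q : {set 'I_n} :=
  [set i | has (fun w : word n => i \in fmonom_val w) (msupp q)].

Definition nc_over I q : bool := nvars q \subset I.

Definition ball_poly I : ncpoly R n := 1 - \sum_(i in I) letter i ^+ 2.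

End Polynomials.

Section Words.
Variable n : nat.
Implicit Type I : {set 'I_n}.

Fixpoint words_eq I (d : nat) : seq (word n) :=
  if d is d'.+1
  then [seq mmul (fmu i) w | i <- enum I, w <- words_eq I d']
  else [:: mone].

Definition words I (d : nat) : seq (word n) :=
  flatten [seq words_eq I i | i <- iota 0 d.+1].

Definition nwords (d r : nat) : nat := \sum_(i < d.+1) r ^ i.

Lemma size_words I d : size (words I d) = nwords d #|I|.
Proof.
have size_eq i : size (words_eq I i) = (#|I| ^ i)%N.
  by elim: i => //= i IH; rewrite size_allpairs IH -cardE expnS.
rewrite /words /nwords size_flatten /shape -map_comp sumnE big_map.
rewrite -[iota 0 d.+1]/(index_iota 0 d.+1) big_mkord.
by apply: eq_bigr => i _ /=.
Qed.

Lemma mem_words I d w :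
  (w \in words I d) = (fdeg w <= d)%N && all (mem I) w.
Proof.
have memeq i v : (v \in words_eq I i) = (fdeg v == i) && all (mem I) v.
  elim: i v => [|i IH] v /=.
    by rewrite inE fdeg_eq0; case: eqP => // ->; rewrite fm1.
  apply/allpairsP/idP => [[[x u] /= [xI uI ->]]|].
    move: uI; rewrite IH fdegM fdegU fmM fmU /= => /andP[/eqP-> ->].
    by rewrite eqxx -mem_enum xI.
  case: v => [[|x v]] //= /andP[dv /andP[xI vI]].
  exists (x, FMonom v); split => /=; first by rewrite mem_enum.
    by rewrite IH /= vI andbT -eqSS.
  by apply: val_inj; rewrite /= fmM fmU.
apply/flatten_mapP/idP => [[i]|/andP[dw wI]].
  by rewrite mem_iota memeq => /andP[_ id] /andP[/eqP-> ->]; rewrite -ltnS id.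
by exists (fdeg w); rewrite ?mem_iota ?memeq ?eqxx.
Qed.

Lemma words_uniq I d : uniq (words I d).
Proof.
have sz i v : v \in words_eq I i -> fdeg v = i.
  elim: i v => [|i IH] v /=; first by rewrite inE => /eqP->; rewrite fdeg1.
  by case/allpairsP=> [[x u] /= [_ /IH ui ->]]; rewrite fdegM fdegU ui.
have uniq_eq i : uniq (words_eq I i).
  elim: i => //= i IH; apply: allpairs_uniq => //; first exact: enum_uniq.
  case=> [x u] [y v] _ _ /(congr1 (@fmonom_val _)) /=.
  by rewrite !fmM !fmU => -[-> /val_inj ->].
rewrite /words; move: {1}0%N => a; elim: d.+1 a => //= k IH a.
rewrite cat_uniq uniq_eq IH andbT; apply/hasPn => v /flatten_mapP[i].
rewrite mem_iota => /andP[ai _] /sz vi; apply/negP => /sz va.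
by move: ai; rewrite -vi va ltnn.
Qed.

(* The column vector W_d^I. *)
Definition wvec I (d : nat) (u : 'I_(nwords d #|I|)) : word n :=
  nth mone (words I d) u.

End Words.
Arguments wvec {n} I d u.

Definition posdefmx (R : realType) (N : nat) (A : 'M[R]_N) : Prop :=
  A^T = A /\ forall v : 'cV[R]_N, v != 0 -> 0 < (v^T *m A *m v) ord0 ord0.

(* Tr(G W q W^* ) for W = W_d^I. *)
Definition gram_tr (R : realType) (n : nat) (I : {set 'I_n}) (d : nat)
    (q : ncpoly R n) (G : 'M[R]_(nwords d #|I|)) : ncpoly R n :=
  \sum_u \sum_v G u v *: (<< wvec I d v >> * q * << wstar (wvec I d u) >>).

Section Problem.
Variables (R : realType) (n m : nat).
Variables (I : {set 'I_n}) (g : 'I_m.+1 -> ncpoly R n) (J : {set 'I_m.+1}).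

(* Position ord0 of the family g carries g_0 = 1, and J is a set of indices of
   genuine constraints g_1, ..., g_m; the index set {0} U J is [ord0 |: J]. *)
Definition Qint (k : nat) (q : ncpoly R n) : Prop :=
  exists G : forall i, 'M[R]_(nwords (k - hdeg (g i)) #|I|),
    (forall i, i \in ord0 |: J -> posdefmx (G i)) /\
    q = \sum_(i in ord0 |: J) gram_tr (g i) (G i).

(* A sequence indexed by W_2k is given by a function y on all words; only its
   values at words of length at most 2k are constrained or used when k >= k_q. *)
Definition riesz (y : word n -> R) (q : ncpoly R n) : R :=
  \sum_(w <- msupp q) q@_w * y w.

Definition loc_mx (y : word n -> R) (d : nat) (q : ncpoly R n) :
    'M[R]_(nwords d #|I|) :=
  \matrix_(u, v)
    riesz y (<< wstar (wvec I d u) >> * q * << wvec I d v >>).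

(* Blocks are listed by increasing index in {0} U J, starting with 0. *)
Definition blk (a : 'I_#|ord0 |: J|) : 'I_m.+1 := enum_val a.

Definition blk_size (k : nat) (a : 'I_#|ord0 |: J|) : nat :=
  nwords (k - hdeg (g (blk a))) #|I|.

(* As g_0 = 1, the block of index 0 is the moment matrix M_k(y, I). *)
Definition Dmx (k : nat) (y : word n -> R) : 'M[R]_(\sum_a blk_size k a) :=
  \mxdiag_(a < #|ord0 |: J|) loc_mx y (k - hdeg (g (blk a))) (g (blk a)).

Definition in_S (k : nat) (P : 'M[R]_(\sum_a blk_size k a)) : Prop :=
  exists Y : forall a, 'M[R]_(blk_size k a),
    (forall a, (Y a)^T = Y a) /\ P = \mxdiag_(a < #|ord0 |: J|) Y a.

Definition in_Spp (k : nat) (P : 'M[R]_(\sum_a blk_size k a)) : Prop :=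
  in_S P /\ posdefmx P.

End Problem.
Arguments blk_size {R n m} I g J k a.

Definition kmin (R : realType) (n m l : nat) (f : ncpoly R n)
    (g : 'I_m.+1 -> ncpoly R n) (h : 'I_l -> ncpoly R n) : nat :=
  maxn (hdeg f)
    (maxn (\max_(i < m.+1 | i != ord0) hdeg (g i)) (\max_(i < l) hdeg (h i))).

Definition CSCTP (R : realType) (n m l p : nat) (f : ncpoly R n)
    (g : 'I_m.+1 -> ncpoly R n) (h : 'I_l -> ncpoly R n)
    (I : 'I_p -> {set 'I_n}) (J : 'I_p -> {set 'I_m.+1})
    (W : 'I_p -> {set 'I_l}) : Prop :=
  forall (k : nat) (j : 'I_p), (kmin f g h <= k)%N ->
  exists (a : R) (P : 'M[R]_(\sum_b blk_size (I j) g (J j) k b)),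
    [/\ 0 < a, in_Spp P
      & forall y : word n -> R,
          (forall w, (fdeg w <= 2 * k)%N -> y w = y (wstar w)) ->
          (forall i, i \in W j ->
             loc_mx (I j) y (k - hdeg (h i)) (h i) = 0) ->
          y mone = 1 ->
          \tr (P *m Dmx (I j) g (J j) k y *m P) = a].

Section Graphs.
Variable V : finType.
Implicit Type E : rel V.

Definition chordal E : Prop :=
  forall c : seq V, uniq c -> cycle E c -> (4 <= size c)%N ->
  exists x y, [/\ x \in c, y \in c, E x y, y != next c x & x != next c y].

Definition is_clique E (A : {set V}) : bool :=
  [forall x in A, forall y in A, (x != y) ==> E x y].

Definition maximal_cliques E (p : nat) (I : 'I_p -> {set V}) : Prop :=
  injective I /\
  forall A : {set V}, maxset (is_clique E) A <-> exists j, I j = A.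

End Graphs.

Definition csp_graph (R : realType) (n m l : nat) (f : ncpoly R n)
    (g : 'I_m.+1 -> ncpoly R n) (h : 'I_l -> ncpoly R n) : rel 'I_n :=
  fun i j => (i != j) &&
    [|| has (fun w : word n => (i \in fmonom_val w) && (j \in fmonom_val w))
            (msupp f),
        [exists t, (i \in nvars (g t)) && (j \in nvars (g t))]
      | [exists t, (i \in nvars (h t)) && (j \in nvars (h t))]].

(* The I_j are the maximal cliques of the csp graph itself or of one of its
   chordal extensions. *)
Definition csp_cliques (n p : nat) (csp : rel 'I_n) (I : 'I_p -> {set 'I_n})
    : Prop :=
  exists E : rel 'I_n,
    [/\ symmetric E, irreflexive E,
        E =2 csp \/ (subrel csp E /\ chordal E)
      & maximal_cliques E I].

(* Unlike [finset.partition], blocks may be empty. *)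
Definition family_partition (T : finType) (p : nat) (J : 'I_p -> {set T})
    (D : {set T}) : Prop :=
  (forall i j, i != j -> [disjoint J i & J j]) /\ \bigcup_j J j = D.

(* Main.v *)
Require Import Defs.
From mathcomp Require Import all_boot all_order all_algebra.
From mathcomp Require Import finmap reals.
From mathcomp.multinomials Require Import monalg.
From mathcomp Require Import spectral complex.

Set Implicit Arguments.
Unset Strict Implicit.
Unset Printing Implicit Defensive.

Import Order.TTheory GRing.Theory Num.Theory.
Local Open Scope ring_scope.

(** Fix a clique I, write W_d for the words of length at most d in its letters
    and let b be its ball polynomial.  Multiplying b by w on the left and w^* on
    the right gives w w^* - sum_i (w X_i)(w X_i)^*, and the words w X_i are
    exactly the words one letter longer; so these expressions telescope along
    the length of w, and with the weights D+1-|w| one gets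
      sum_{w in W_(D+1)} w w^* + sum_{w in W_D} (D+1-|w|) w b w^* = D + 2
    ([ball_identity]).  For D = k - ceil(deg b / 2) the left side is the sum of
    the Gram expressions of the constraints 1 and b, for the identity matrix and
    a positive diagonal matrix.

    The remaining constraints have to enter with positive definite matrices too.
    Give each of them e times the identity.  Their total contribution e q is a
    symmetric polynomial of degree at most 2k in the letters of I, hence
    q = Tr(H W_k W_k^* ) for some symmetric H ([gram_representable_sandwich]),
    and it is compensated by replacing the identity matrix of the constraint 1
    with 1 - e H, which stays positive definite for small e ([posdefmx_near1]).
    Scaling yields every positive constant ([Qint_const]).

    For the constant trace property, apply L_y to such a decomposition of the
    constant 1.  The Gram expression pairs G(u,v) with v g u^*, while the
    localizing matrix has the entries L_y(u^* g v); the involution permutes W_d,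
    so after reindexing G by it, L_y of the Gram expression is the trace of G
    times the localizing matrix ([riesz_gram_tr]).  If P is the block diagonal
    matrix of the positive definite square roots of these G, then Tr(P D P) is
    Tr(P^2 D) = L_y(1) = y_1 = 1 for every y ([Qint_constant_trace]).  The
    square roots come from the spectral theorem ([posdefmx_sqrt]). *)

(** * Positive definite matrices *)

Lemma sqnorm_gt0 (R : realDomainType) (N : nat) (v : 'cV[R]_N) :
  v != 0 -> 0 < (v^T *m v) ord0 ord0.
Proof.
move=> v0; have [i vi] : exists i, v i ord0 != 0.
  apply/existsP; apply: contraNT v0; rewrite negb_exists => /forallP v0.
  by apply/eqP/colP => i; rewrite mxE; apply/eqP; rewrite -[_ == _]negbK.
rewrite mxE (bigD1 i) //= mxE ltr_wpDr //; last first.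
  by rewrite lt_def mulf_neq0 //= -expr2 sqr_ge0.
by apply: sumr_ge0 => j _; rewrite mxE -expr2 sqr_ge0.
Qed.

(** Over R[i] the matrix is Hermitian, hence unitarily diagonalizable with a
    real diagonal; two real matrices similar over R[i] are similar over R.  The
    rows of P are eigenvectors, but P need not be orthogonal. *)
Lemma symmetric_diagonalizable (R : rcfType) (N : nat) (A : 'M[R]_N) :
  A^T = A -> exists P (d : 'rV[R]_N),
    P \in unitmx /\ P *m A = diag_mx d *m P.
Proof.
move=> Asym; pose toC := real_complex R; pose AC := map_mx toC A.
have ACreal : AC \is a realmx.
  by apply/mxOverP => i j; rewrite mxE; apply/complex_realP; exists (A i j).
have ACherm : AC \is hermsymmx.
  apply: realsym_hermsym => //; apply/is_hermitianmxP.
  rewrite expr0 scale1r map_mx_id //.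
  by apply/matrixP => i j; rewrite !mxE -{1}Asym mxE.
have Dreal := hermitian_spectral_diag_real ACherm.
have /orthomx_spectralP ACE := hermitian_normalmx ACherm.
have := spectral_unit AC.
move: (spectralmx AC) (spectral_diag AC) Dreal ACE => S D Dreal ACE Sunit.
have DDreal : diag_mx D \is a realmx.
  apply/mxOverP => i j; rewrite mxE; case: eqP => _; rewrite ?mulr0n ?mulr1n.
    exact: (mxOverP Dreal).
  exact: real0.
have /real_similar : similar_in unitmx AC (diag_mx D).
  exists S => //; apply/similarP => //.
  by rewrite ACE !mulmxA mulmxV // mul1mx.
case/(_ ACreal DDreal) => P; rewrite inE => /andP[Preal Punit].
move/(similarP Punit) => PA.
pose Q := map_mx (@complex.Re R) P; pose d := map_mx (@complex.Re R) D.
have lift a b (X : 'M[R[i]]_(a, b)) : X \is a realmx ->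
    map_mx toC (map_mx (@complex.Re R) X) = X.
  move=> Xreal; apply/matrixP => i j; rewrite !mxE.
  by apply: RRe_real; apply: (mxOverP Xreal).
exists Q, d; split.
  by rewrite -(map_unitmx toC) lift.
apply: (map_mx_inj (f := toC)).
by rewrite !map_mxM map_diag_mx !lift.
Qed.

Lemma posdefmx_tr_mul (R : realType) (N : nat) (S : 'M[R]_N) :
  S \in unitmx -> posdefmx (S^T *m S).
Proof.
move=> Sunit; split=> [|v v0]; first by rewrite trmx_mul trmxK.
rewrite mulmxA -trmx_mul -mulmxA; apply: sqnorm_gt0.
by apply: contraNneq v0 => Sv0; rewrite -(mulKmx Sunit v) Sv0 mulmx0.
Qed.

(** With A = P^-1 diag(d) P, the matrix C = P^-1 diag(d^(1/4)) P is a fourth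
    root.  It is symmetric although P need not be orthogonal: symmetry of A says
    that P P^T commutes with diag(d), hence with any function of it.  Then
    C C = C^T C is a positive definite square root of A. *)
Lemma posdefmx_sqrt (R : realType) (N : nat) (A : 'M[R]_N) :
  posdefmx A -> exists2 B, posdefmx B & B *m B = A.
Proof.
move=> [Asym Apos]; have [P [d [Punit PA]]] := symmetric_diagonalizable Asym.
(* Row i of P is a left eigenvector for d_i, so its quadratic form under A is
   d_i times its squared norm. *)
have dpos i : 0 < d ord0 i.
  pose v := (row i P)^T.
  have v0 : v != 0.
    apply: contraTneq Punit => /(congr1 trmx); rewrite trmxK trmx0 => Pi0.
    rewrite unitmxE unitfE negbK (expand_det_row _ i) big1 // => j _.
    by have /rowP/(_ j) := Pi0; rewrite !mxE => ->; rewrite mul0r.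
  have := Apos v v0; rewrite trmxK -row_mul PA row_mul row_diag_mx.
  rewrite -scalemxAl -rowE -scalemxAl mxE.
  by rewrite pmulr_lgt0 // -[row i P]trmxK; apply: sqnorm_gt0.
have PPd : P *m P^T *m diag_mx d = diag_mx d *m (P *m P^T).
  by rewrite -mulmxA -{1}tr_diag_mx -trmx_mul -PA trmx_mul Asym !mulmxA PA.
pose q (x : R) := Num.sqrt (Num.sqrt x); pose D := diag_mx (map_mx q d).
have Dq : D *m D *m (D *m D) = diag_mx d.
  rewrite !mulmx_diag; congr diag_mx; apply/rowP => i; rewrite !mxE.
  by rewrite -!expr2 !sqr_sqrtr ?sqrtr_ge0 // ltW.
(* Entrywise, (P P^T)_(i,j) vanishes unless d_i = d_j. *)
have PPD : P *m P^T *m D = D *m (P *m P^T).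
  apply/matrixP => i j; rewrite mul_mx_diag mul_diag_mx !mxE.
  have /matrixP/(_ i j) := PPd; rewrite mul_mx_diag mul_diag_mx !mxE.
  rewrite mulrC => /eqP; rewrite -subr_eq0 -mulrBl mulf_eq0 subr_eq0.
  by case/orP => /eqP->; rewrite ?mulr0 ?mul0r // mulrC.
pose C := invmx P *m D *m P.
have Cunit : C \in unitmx.
  rewrite !unitmx_mul unitmx_inv Punit /= andbT unitmxE det_diag unitfE.
  by apply/prodf_neq0 => i _; rewrite mxE !gt_eqF // !sqrtr_gt0.
have Csym : C^T = C.
  have PTunit : P^T \in unitmx by rewrite unitmx_tr.
  rewrite /C !trmx_mul tr_diag_mx -/D trmx_inv.
  rewrite -[LHS](mulKmx Punit) -!mulmxA; congr (_ *m _).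
  by rewrite !mulmxA PPD -!mulmxA mulmxV // mulmx1.
exists (C *m C).
  by rewrite -{1}Csym; apply: posdefmx_tr_mul.
rewrite /C !mulmxA !(mulmxKV Punit, mulmxK Punit) -!mulmxA.
by apply: (canLR (mulKmx Punit)); rewrite PA !mulmxA -(mulmxA (D *m D)) Dq.
Qed.

Lemma quad_formE (R : pzRingType) (N : nat) (A : 'M[R]_N) (v : 'cV[R]_N) :
  (v^T *m A *m v) ord0 ord0 =
  \sum_i \sum_j v i ord0 * A i j * v j ord0.
Proof.
rewrite mxE exchange_big; apply: eq_bigr => j _ /=.
by rewrite mxE mulr_suml; apply: eq_bigr => i _; rewrite mxE.
Qed.

Lemma posdefmxZ (R : realType) (N : nat) (c : R) (A : 'M[R]_N) :
  0 < c -> posdefmx A -> posdefmx (c *: A).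
Proof.
move=> c0 [Asym Apos]; split=> [|v v0]; first by rewrite linearZ /= Asym.
by rewrite -scalemxAr -scalemxAl mxE mulr_gt0 ?Apos.
Qed.

Lemma posdefmx_diag (R : realType) (N : nat) (d : 'rV[R]_N) :
  (forall i, 0 < d ord0 i) -> posdefmx (diag_mx d).
Proof.
move=> d0; pose S := diag_mx (map_mx Num.sqrt d).
have -> : diag_mx d = S^T *m S.
  rewrite tr_diag_mx mulmx_diag; congr diag_mx; apply/rowP => i.
  by rewrite !mxE -expr2 sqr_sqrtr // ltW.
apply: posdefmx_tr_mul; rewrite unitmxE det_diag unitfE.
by apply/prodf_neq0 => i _; rewrite mxE gt_eqF // sqrtr_gt0.
Qed.

Lemma posdefmx1 (R : realType) (N : nat) : posdefmx (1%:M : 'M[R]_N).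
Proof. by rewrite -diag_const_mx; apply: posdefmx_diag => i; rewrite mxE. Qed.

Lemma posdefmx_reindex (R : realType) (N : nat) (f : 'I_N -> 'I_N)
    (A : 'M[R]_N) :
  involutive f -> posdefmx A -> posdefmx (mxsub f f A).
Proof.
move=> ff [Asym Apos]; split=> [|v v0]; first by rewrite trmx_mxsub Asym.
have fv0 : rowsub f v != 0.
  apply: contraNneq v0 => /colP v0; apply/eqP/colP => i.
  by have := v0 (f i); rewrite !mxE ff.
have := Apos _ fv0; rewrite !quad_formE (reindex_inj (inv_inj ff)) /=.
congr (0 < _); apply: eq_bigr => i _; rewrite (reindex_inj (inv_inj ff)) /=.
by apply: eq_bigr => j _; rewrite !mxE !ff.
Qed.

Lemma posdefmx_mxdiag (R : realType) (q : nat) (s : 'I_q -> nat)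
    (Y : forall a, 'M[R]_(s a)) :
  (forall a, posdefmx (Y a)) -> posdefmx (\mxdiag_(a < q) Y a).
Proof.
move=> Ypos; split=> [|v v0].
  by rewrite tr_mxdiag; apply: eq_mxdiag => a; case: (Ypos a).
have [a va0] : exists a, submxcol v a != 0.
  apply/existsP; apply: contraNT v0; rewrite negb_exists => /forallP v0.
  apply/eqP/mxcolP => a; rewrite submxcol0.
  by apply/eqP; rewrite -[_ == _]negbK.
rewrite -(submxcolK v) tr_mxcol mul_mxrow_mxdiag mul_mxrow_mxcol summxE.
rewrite (bigD1 a) //= ltr_wpDr //; last by case: (Ypos a) => _; apply.
apply: sumr_ge0 => b _; have [_ Yb] := Ypos b.
have [->|vb0] := eqVneq (submxcol v b) 0; first by rewrite mulmx0 mxE.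
exact/ltW/Yb.
Qed.

(** The quadratic form of H is at most M |v|^2, where M is the sum of the
    absolute values of the entries of H; so e = 1 / (1 + M) works. *)
Lemma posdefmx_near1 (R : realType) (N : nat) (H : 'M[R]_N) :
  H^T = H -> exists2 e : R, 0 < e & posdefmx (1%:M - e *: H).
Proof.
move=> Hsym; pose M : R := \sum_i \sum_j `|H i j|.
have M0 : 0 <= M by apply: sumr_ge0 => i _; apply: sumr_ge0.
have M1 : 0 < 1 + M by rewrite ltr_wpDr.
exists (1 + M)^-1; first by rewrite invr_gt0.
split=> [|v v0]; first by rewrite linearB linearZ /= trmx1 Hsym.
have s0 := sqnorm_gt0 v0; pose s := (v^T *m v) ord0 ord0; rewrite -/s in s0.
have vs i : `|v i ord0| <= Num.sqrt s.
  rewrite -sqrtr_sqr; apply: ler_wsqrtr; rewrite /s mxE (bigD1 i) //= mxE.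
  rewrite -expr2 lerDl; apply: sumr_ge0 => j _.
  by rewrite mxE -expr2 sqr_ge0.
have Hv : (v^T *m H *m v) ord0 ord0 <= M * s.
  rewrite quad_formE /M mulr_suml; apply: ler_sum => i _.
  rewrite mulr_suml; apply: ler_sum => j _.
  apply: le_trans (ler_norm _) _; rewrite !normrM mulrAC mulrC.
  rewrite ler_wpM2l // -(sqr_sqrtr (ltW s0)) expr2.
  exact: ler_pM.
rewrite mulmxBr mulmx1 mulmxBl -scalemxAr -scalemxAl mxE.
rewrite [X in _ + X]mxE [X in _ - X]mxE -/s subr_gt0.
rewrite -[X in _ < X](mulKf (lt0r_neq0 M1)) ltr_pM2l ?invr_gt0 //.
by apply: le_lt_trans Hv _; rewrite ltr_pM2r // ltrDr.
Qed.

(** * Words *)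

Section WordLemmas.
Variable n : nat.
Implicit Types (I : {set 'I_n}) (u v w : word n).

Lemma wstarK : involutive (@wstar n).
Proof. by case=> s; rewrite /wstar /= revK. Qed.

Lemma wstarM u v : wstar (mmul u v) = mmul (wstar v) (wstar u).
Proof. by apply: val_inj; rewrite /= !fmM rev_cat. Qed.

Lemma wstar_fmu (i : 'I_n) : wstar (fmu i) = fmu i.
Proof. by apply: val_inj; rewrite /= fmU. Qed.

Lemma wstar1 : wstar (mone : word n) = mone.
Proof. by apply: val_inj; rewrite /= fm1. Qed.

Lemma wstar_words I d w : (wstar w \in words I d) = (w \in words I d).
Proof. by rewrite !mem_words all_rev !fdegE size_rev. Qed.

Lemma wvec_words I d (u : 'I_(nwords d #|I|)) : wvec I d u \in words I d.
Proof. by rewrite mem_nth // size_words. Qed.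

Lemma wvec_inj I d : injective (@wvec n I d).
Proof.
move=> u v /eqP; rewrite nth_uniq ?size_words ?words_uniq // => /eqP.
exact: val_inj.
Qed.

Lemma wordsP I d w :
  w \in words I d -> exists u : 'I_(nwords d #|I|), wvec I d u = w.
Proof.
move=> wI; have ltw : (index w (words I d) < nwords d #|I|)%N.
  by rewrite -size_words index_mem.
by exists (Ordinal ltw); rewrite /wvec nth_index.
Qed.

Lemma sum_wvec (V : nmodType) I d (F : word n -> V) :
  \sum_u F (wvec I d u) = \sum_(w <- words I d) F w.
Proof. by rewrite (big_nth mone) size_words big_mkord. Qed.

Lemma sum_words (V : nmodType) I d (F : word n -> V) :
  \sum_(w <- words I d) F w =
  \sum_(0 <= i < d.+1) \sum_(w <- words_eq I i) F w.
Proof. by rewrite big_flatten big_map /index_iota subn0. Qed.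

Lemma fdeg_words_eq I d w : w \in words_eq I d -> fdeg w = d.
Proof.
elim: d w => [|d IH] w /=; first by rewrite inE => /eqP->; rewrite fdeg1.
by case/allpairsP=> [[x u] /= [_ /IH ui ->]]; rewrite fdegM fdegU ui.
Qed.

(** Cut w in its middle: the first k letters give v, the rest, of length at most
    k, is u^*. *)
Lemma words_split I k w : (fdeg w <= 2 * k)%N -> all (mem I) w ->
  exists u v : 'I_(nwords k #|I|), w = mmul (wvec I k v) (wstar (wvec I k u)).
Proof.
rewrite fdegE => wk wI; pose a := FMonom (take k w).
pose b := FMonom (rev (drop k w)).
have [v va] : exists v : 'I_(nwords k #|I|), wvec I k v = a.
  apply: wordsP; rewrite mem_words fdegE /a /= size_take_min geq_minl /=.
  by apply/allP => x /mem_take; apply/allP.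
have [u ub] : exists u : 'I_(nwords k #|I|), wvec I k u = b.
  apply: wordsP; rewrite mem_words fdegE /b /= size_rev size_drop all_rev.
  rewrite leq_subLR addnn -mul2n wk.
  by apply/allP => x /mem_drop; apply/allP.
exists u, v; rewrite va ub; apply: val_inj.
by rewrite /= fmM /= revK cat_take_drop.
Qed.

Lemma sum_words_eqSl (V : nmodType) I d (F : word n -> V) :
  \sum_(w <- words_eq I d.+1) F w =
  \sum_(i in I) \sum_(w <- words_eq I d) F (mmul (fmu i) w).
Proof. by rewrite [LHS]big_allpairs_dep big_enum. Qed.

(** The words of length d+1 are enumerated by their first letter; here they are
    enumerated by their last one, which is what multiplying the ball polynomial
    by w on the left and by w^* on the right produces. *)
Lemma sum_words_eqSr (V : nmodType) I d (F : word n -> V) :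
  \sum_(w <- words_eq I d.+1) F w =
  \sum_(w <- words_eq I d) \sum_(i in I) F (mmul w (fmu i)).
Proof.
elim: d F => [|d IH] F.
  rewrite sum_words_eqSl /= big_seq1; apply: eq_bigr => i _.
  by rewrite big_seq1 mulm1 mul1m.
rewrite sum_words_eqSl [RHS]sum_words_eqSl; apply: eq_bigr => i _.
rewrite IH; apply: eq_bigr => w _; apply: eq_bigr => j _.
by rewrite mulmA.
Qed.

End WordLemmas.

(** * Gram expressions *)

Section MatrixSums.
Variables (R : nzRingType) (V : lmodType R) (N : nat).
Implicit Types (u v : 'I_N) (F : 'I_N -> 'I_N -> V).

Lemma sum_delta_mx u v F :
  \sum_a \sum_b (delta_mx u v : 'M[R]_N) a b *: F a b = F u v.
Proof.
rewrite (bigD1 u) //= (bigD1 v) //= big1 => [|b bv]; last first.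
  by rewrite mxE (negPf bv) andbF scale0r.
rewrite big1 => [|a au]; last first.
  by apply: big1 => b _; rewrite mxE (negPf au) scale0r.
by rewrite mxE !eqxx scale1r !addr0.
Qed.

Lemma sum_diag_mx (d : 'rV[R]_N) F :
  \sum_a \sum_b diag_mx d a b *: F a b = \sum_a d ord0 a *: F a a.
Proof.
apply: eq_bigr => a _; rewrite (bigD1 a) //= big1 => [|b ba].
  by rewrite mxE eqxx mulr1n addr0.
by rewrite mxE eq_sym (negPf ba) mulr0n scale0r.
Qed.

End MatrixSums.

Section PolyLemmas.
Variables (R : realType) (n : nat).
Implicit Types (I : {set 'I_n}) (u v w : word n) (q : ncpoly R n).

Lemma monomM (a b : R) u v :
  << a *g u >> * << b *g v >> = << a * b *g mmul u v >> :> ncpoly R n.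
Proof. exact: fgmulUU. Qed.

Lemma monomZ (a b : R) u : a *: << b *g u >> = << a * b *g u >> :> ncpoly R n.
Proof.
by apply/malgP => w; rewrite mcoeffZ !mcoeffU mulrnAr.
Qed.

Lemma gram_trB I d q (G H : 'M[R]_(nwords d #|I|)) :
  gram_tr q (G - H) = gram_tr q G - gram_tr q H.
Proof.
rewrite /gram_tr -sumrB; apply: eq_bigr => u _; rewrite -sumrB.
by apply: eq_bigr => v _; rewrite !mxE scalerBl.
Qed.

Lemma gram_trD I d q (G H : 'M[R]_(nwords d #|I|)) :
  gram_tr q (G + H) = gram_tr q G + gram_tr q H.
Proof.
rewrite /gram_tr -big_split; apply: eq_bigr => u _; rewrite -big_split.
by apply: eq_bigr => v _; rewrite !mxE scalerDl.
Qed.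

Lemma gram_trZ I d q c (G : 'M[R]_(nwords d #|I|)) :
  gram_tr q (c *: G) = c *: gram_tr q G.
Proof.
rewrite /gram_tr scaler_sumr; apply: eq_bigr => u _; rewrite scaler_sumr.
by apply: eq_bigr => v _; rewrite !mxE scalerA.
Qed.

Lemma gram_tr_delta I d q (u v : 'I_(nwords d #|I|)) :
  gram_tr q (delta_mx u v) =
  << wvec I d v >> * q * << wstar (wvec I d u) >>.
Proof.
exact: (sum_delta_mx (V := ncpoly R n) u v (fun a b =>
  << wvec I d b >> * q * << wstar (wvec I d a) >>)).
Qed.

Lemma gram_tr_diag I d q (a : word n -> R) :
  gram_tr q (diag_mx (\row_u a (wvec I d u))) =
  \sum_(w <- words I d) a w *: (<< w >> * q * << wstar w >>).
Proof.
rewrite -sum_wvec /gram_tr.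
rewrite (sum_diag_mx (V := ncpoly R n) _ (fun a b =>
  << wvec I d b >> * q * << wstar (wvec I d a) >>)).
by apply: eq_bigr => u _; rewrite mxE.
Qed.

Lemma gram_tr1 I d q :
  gram_tr q (1%:M : 'M[R]_(nwords d #|I|)) =
  \sum_(w <- words I d) << w >> * q * << wstar w >>.
Proof.
rewrite -diag_const_mx -sum_wvec /gram_tr.
rewrite (sum_diag_mx (V := ncpoly R n) _ (fun a b =>
  << wvec I d b >> * q * << wstar (wvec I d a) >>)).
by apply: eq_bigr => u _; rewrite mxE scale1r.
Qed.

(** H need not be semidefinite: these are the perturbations that the
    Gram matrix of the constraint 1 can absorb. *)
Definition gram_representable I k q :=
  exists2 H : 'M[R]_(nwords k #|I|), H^T = H & q = gram_tr 1 H.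

Lemma gram_representable_sum I k (T : eqType) (r : seq T) (P : pred T)
    (F : T -> ncpoly R n) :
  (forall t, t \in r -> P t -> gram_representable I k (F t)) ->
  gram_representable I k (\sum_(t <- r | P t) F t).
Proof.
move=> rF; rewrite big_seq_cond.
elim/big_ind: _ => [|p q [G Gs ->] [H Hs ->]|t /andP[]]; last exact: rF.
  exists 0; first by rewrite trmx0.
  rewrite /gram_tr !big1 // => u _; rewrite big1 // => v _.
  by rewrite mxE scale0r.
by exists (G + H); rewrite ?gram_trD // linearD /= Gs Hs.
Qed.

Lemma gram_representable_word I k c w :
  (fdeg w <= 2 * k)%N -> all (mem I) w ->
  gram_representable I k (<< c *g w >> + << c *g wstar w >>).
Proof.
move=> wk wI; have [u [v ->]] := words_split wk wI.
exists (c *: (delta_mx u v + delta_mx v u)).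
  by rewrite linearZ linearD /= !trmx_delta addrC.
rewrite gram_trZ gram_trD !gram_tr_delta !mulr1 !monomM mulr1 wstarM wstarK.
by rewrite scalerDr !monomZ mulr1.
Qed.

Lemma sandwichE q v : << v >> * q * << wstar v >> =
  \sum_(w <- msupp q) << q@_w *g mmul (mmul v w) (wstar v) >>.
Proof.
rewrite {1}[q]monalgE mulr_sumr mulr_suml; apply: eq_bigr => w _.
by rewrite !monomM mul1r mulr1.
Qed.

Lemma sandwich_starE q v : ncsym q -> << v >> * q * << wstar v >> =
  \sum_(w <- msupp q) << q@_w *g wstar (mmul (mmul v w) (wstar v)) >>.
Proof.
move=> qsym; rewrite -{1}qsym mulr_sumr mulr_suml; apply: eq_bigr => w _.
by rewrite !monomM mul1r mulr1 !wstarM wstarK mulmA.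
Qed.

Lemma fdeg_ncdeg q w : w \in msupp q -> (fdeg w <= ncdeg q)%N.
Proof. by move=> wq; apply: leq_bigmax_seq. Qed.

Lemma nc_over_mem I q w : nc_over I q -> w \in msupp q -> all (mem I) w.
Proof.
move=> /subsetP qI wq; apply/allP => i iw; apply: qI; rewrite inE.
by apply/hasP; exists w.
Qed.

(** As q is symmetric, v q v^* is the average of itself and its image under the
    involution, so its monomials c w occur in pairs (c/2) (w + w^* ), each of
    which comes from two transposed entries of H. *)
Lemma gram_representable_sandwich I k q v :
  ncsym q -> nc_over I q -> (hdeg q <= k)%N -> v \in words I (k - hdeg q) ->
  gram_representable I k (<< v >> * q * << wstar v >>).
Proof.
move=> qsym qI qk; rewrite mem_words => /andP[vk vI].
have -> : << v >> * q * << wstar v >> = \sum_(w <- msupp q)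
   (<< q@_w / 2 *g mmul (mmul v w) (wstar v) >> +
    << q@_w / 2 *g wstar (mmul (mmul v w) (wstar v)) >>).
  have half (p : ncpoly R n) : p = 2^-1 *: (p + p).
    by rewrite -mulr2n -scaler_nat scalerA mulVf ?scale1r ?pnatr_eq0.
  rewrite [LHS]half {1}sandwichE sandwich_starE // -big_split scaler_sumr.
  by apply: eq_bigr => w _; rewrite scalerDr !monomZ ![2^-1 * _]mulrC.
apply: gram_representable_sum => w wq _; apply: gram_representable_word.
  rewrite !fdegM [fdeg (wstar v)]fdegE size_rev -fdegE.
  have := fdeg_ncdeg wq; have : (ncdeg q <= 2 * hdeg q)%N.
    by rewrite /hdeg mul2n -[X in (X <= _)%N]odd_double_half uphalf_half
      doubleD leq_add2r; case: odd.
  move: vk; rewrite /= leq_subRL // => vk dq wd.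
  rewrite addnAC addnn -mul2n.
  apply: (leq_trans (leq_add (leqnn _) (leq_trans wd dq))).
  by rewrite -mulnDr leq_mul2l /= addnC.
by rewrite !fmM !all_cat all_rev (nc_over_mem qI wq) vI.
Qed.

End PolyLemmas.

(** * The ball constraint *)

(** The weighted sum is the sum over j <= D of the telescoping sums
    sum_{i <= j} (E_i - E_(i+1)) = E_0 - E_(j+1). *)
Lemma weighted_telescope (V : zmodType) (E : nat -> V) (D : nat) :
  \sum_(0 <= i < D.+2) E i + \sum_(0 <= i < D.+1) (E i - E i.+1) *+ (D.+1 - i) =
  E 0%N *+ D.+2.
Proof.
elim: D => [|D IH].
  by rewrite big_nat_recr // !big_nat1 subn0 mulr1n addrACA subrr addr0 mulr2n.
have step : \sum_(0 <= i < D.+1) (E i - E i.+1) *+ (D.+2 - i) =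
    \sum_(0 <= i < D.+1) (E i - E i.+1) *+ (D.+1 - i) + (E 0%N - E D.+1).
  rewrite -opprB -(telescope_sumr E (leq0n D.+1)) -sumrN -big_split.
  by apply: eq_big_nat => i /andP[_ iD]; rewrite opprB subSn 1?ltnW // mulrSr.
rewrite big_nat_recr // [X in _ + X]big_nat_recr //= step subSnn mulr1n.
rewrite mulrSr -IH addrACA -!addrA; congr (_ + (_ + _)).
by rewrite [E D.+2 + _]addrCA subrr addr0 addNr addr0.
Qed.

Section Ball.
Variables (R : realType) (n : nat).
Implicit Types (I : {set 'I_n}) (w : word n).

Lemma ball_polyE I :
  ball_poly R I = 1 - \sum_(i in I) << mmul (fmu i) (fmu i) >>.
Proof.
by congr (_ - _); apply: eq_bigr => i _; rewrite expr2 monomM mulr1.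
Qed.

Lemma ball_poly_coef I w :
  (ball_poly R I)@_w =
  (w == mone)%:R - \sum_(i in I) (mmul (fmu i) (fmu i) == w)%:R.
Proof.
rewrite ball_polyE mcoeffB mcoeff1 raddf_sum; congr (_ - _).
by apply: eq_bigr => i _; rewrite /= mcoeffU.
Qed.

Lemma hdeg_ball I : I != set0 -> hdeg (ball_poly R I) = 1%N.
Proof.
case/set0Pn => i iI; rewrite /hdeg; suff -> : ncdeg (ball_poly R I) = 2%N by [].
apply/eqP; rewrite eqn_leq; apply/andP; split.
  apply/bigmax_leqP_seq => w; rewrite -mcoeff_neq0 ball_poly_coef => + _.
  apply: contraR; rewrite -ltnNge => w2.
  have -> : (w == mone) = false.
    by apply: contraTF w2 => /eqP->; rewrite fdeg1.
  rewrite big1 ?subrr ?eqxx // => j _.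
  have -> // : (mmul (fmu j) (fmu j) == w) = false.
  by apply: contraTF w2 => /eqP<-; rewrite fdegM !fdegU.
have -> : 2%N = fdeg (mmul (fmu i) (fmu i) : word n) by rewrite fdegM !fdegU.
apply: fdeg_ncdeg; rewrite -mcoeff_neq0 ball_poly_coef.
have -> : (mmul (fmu i) (fmu i) == mone :> word n) = false.
  by rewrite -fdeg_eq0 fdegM !fdegU.
rewrite sub0r oppr_eq0 (bigD1 i) //= eqxx gt_eqF // ltr_wpDr //.
by apply: sumr_ge0 => j _; rewrite ler0n.
Qed.

Lemma words_set0 d : words (set0 : {set 'I_n}) d = [:: mone].
Proof.
rewrite /words /=; congr (_ :: _).
suff flat0 i :
    flatten [seq words_eq (set0 : {set 'I_n}) j | j <- iota i.+1 d] = [::].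
  exact: flat0.
by elim: d i => [|d IH] i //; rewrite /= enum_set0 IH.
Qed.

(** The ball polynomial has degree 2 if I is nonempty, and is the constant 1
    otherwise; in the latter case the empty word is the only word. *)
Lemma words_ball I k : (hdeg (ball_poly R I) <= k)%N ->
  words I (k - hdeg (ball_poly R I)).+1 = words I k.
Proof.
have [->|I0] := eqVneq I set0; first by rewrite !words_set0.
by rewrite hdeg_ball // subn1 => /prednK->.
Qed.

Lemma sandwich_ball I w :
  << w >> * ball_poly R I * << wstar w >> = << mmul w (wstar w) >> -
  \sum_(i in I) << mmul (mmul w (fmu i)) (wstar (mmul w (fmu i))) >>.
Proof.
rewrite ball_polyE mulrBr mulrBl mulr1 monomM mulr1 mulr_sumr mulr_suml.
congr (_ - _); apply: eq_bigr => i _.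
by rewrite !monomM !mulr1 wstarM wstar_fmu !mulmA.
Qed.

(** With E_i the sum of w w^* over the words of length i, the words of length i
    contribute E_i - E_(i+1) for each unit of weight. *)
Lemma ball_identity I D :
  \sum_(w <- words I D.+1) << w >> * 1 * << wstar w >> +
  \sum_(w <- words I D) (D.+1 - fdeg w)%:R *:
    (<< w >> * ball_poly R I * << wstar w >>) = D.+2%:R%:MP.
Proof.
pose E i : ncpoly R n := \sum_(w <- words_eq I i) << mmul w (wstar w) >>.
transitivity (E 0%N *+ D.+2); last first.
  by rewrite /E big_seq1 wstar1 mulm1 -monalgUMn.
rewrite -weighted_telescope !sum_words; congr (_ + _).
  apply: eq_bigr => i _; apply: eq_bigr => w _.
  by rewrite mulr1 monomM mulr1.
apply: eq_bigr => i _; rewrite /E sum_words_eqSr -sumrB -sumrMnl.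
rewrite big_seq [RHS]big_seq; apply: eq_bigr => w /fdeg_words_eq ->.
by rewrite scaler_nat sandwich_ball.
Qed.

End Ball.

(** * Positive constants *)

Section Interior.
Variables (R : realType) (n : nat).
Implicit Types (I : {set 'I_n}) (q p : ncpoly R n).

(** The matrix size d is separate from q, so that equations about k - hdeg q can
    be rewritten. *)
Definition gram_interior I d q p :=
  exists2 G : 'M[R]_(nwords d #|I|), posdefmx G & p = gram_tr q G.

Lemma Qint_sum (m : nat) I (g : 'I_m.+1 -> ncpoly R n) (J : {set 'I_m.+1}) k
    (F : 'I_m.+1 -> ncpoly R n) :
  (forall i, i \in ord0 |: J -> gram_interior I (k - hdeg (g i)) (g i) (F i)) ->
  Qint I g J k (\sum_(i in ord0 |: J) F i).
Proof.
move=> FG.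
have /fin_all_exists[G GP] i : exists G : 'M[R]_(nwords (k - hdeg (g i)) #|I|),
    i \in ord0 |: J -> posdefmx G /\ F i = gram_tr (g i) G.
  have [iJ|_] := boolP (i \in ord0 |: J); last by exists 0.
  by have [G Gpos Fi] := FG i iJ; exists G.
exists G; split=> [i /GP[]//|]; apply: eq_bigr => i iJ.
by case: (GP i iJ).
Qed.

Lemma gram_interiorZ I d q p (c : R) :
  0 < c -> gram_interior I d q p -> gram_interior I d q (c *: p).
Proof.
move=> c0 [G Gpos ->]; exists (c *: G); first exact: posdefmxZ.
by rewrite gram_trZ.
Qed.

Lemma hdeg1 : hdeg (1 : ncpoly R n) = 0%N.
Proof. by rewrite /hdeg /ncdeg msuppU1 big_seq_fset1 fdeg1. Qed.

Lemma sum_setU1_cases (V : nmodType) (m : nat) (J : {set 'I_m.+1}) b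
    (A B : V) (F : 'I_m.+1 -> V) : ord0 \notin J -> b \in J ->
  \sum_(i in ord0 |: J) (if i == ord0 then A else if i == b then B else F i) =
  A + B + \sum_(i in J | i != b) F i.
Proof.
move=> J0 bJ; have b0 : b != ord0 by apply: contraNneq J0 => <-.
rewrite big_setU1 //= (bigD1 b) //= (negPf b0) eqxx addrA; congr (_ + _).
apply: eq_bigr => i /andP[iJ /negPf->]; case: eqP => // i0.
by rewrite -i0 iJ in J0.
Qed.

Lemma Qint_const (m : nat) I (g : 'I_m.+1 -> ncpoly R n) (J : {set 'I_m.+1})
    k b (c : R) :
  g ord0 = 1 -> ord0 \notin J ->
  (forall i, i \in J ->
     [/\ ncsym (g i), nc_over I (g i) & (hdeg (g i) <= k)%N]) ->
  b \in J -> g b = ball_poly R I -> 0 < c -> Qint I g J k c%:MP.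
Proof.
move=> g0 J0 gJ bJ gb c0.
pose F i := gram_tr (g i) (1%:M : 'M[R]_(nwords (k - hdeg (g i)) #|I|)).
have [H Hsym FH] : gram_representable I k (\sum_(i in J | i != b) F i).
  apply: gram_representable_sum => i _ /andP[/gJ[gs gI gk] _].
  rewrite /F gram_tr1; apply: gram_representable_sum => w wI _.
  exact: gram_representable_sandwich.
have [e e0 He] := posdefmx_near1 Hsym.
(* The factor r turns the constant D + 2 of the ball identity into c. *)
pose D := (k - hdeg (g b))%N; pose r := c / D.+2%:R.
have rD : r * D.+2%:R = c by rewrite divfK // pnatr_eq0.
have r0 : 0 < r by rewrite divr_gt0 // ltr0n.
pose B := \sum_(w <- words I D) (D.+1 - fdeg w)%:R *:
    (<< w >> * g b * << wstar w >>).
have -> : c%:MP = \sum_(i in ord0 |: J) r *: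
    (if i == ord0 then gram_tr 1 (1%:M - e *: H)
     else if i == b then B else e *: F i).
  rewrite -scaler_sumr (sum_setU1_cases _ _ _ J0 bJ) -scaler_sumr FH.
  rewrite gram_trB gram_trZ addrAC subrK gram_tr1.
  have <- : words I D.+1 = words I k.
    by rewrite /D gb words_ball // -gb; case: (gJ b bJ).
  rewrite /B gb ball_identity monomZ rD; reflexivity.
apply: Qint_sum => i iJ; apply: gram_interiorZ => //.
case: eqP iJ => [->|/eqP i0] iJ.
  by rewrite g0 hdeg1 subn0; apply: ex_intro2 He erefl.
case: eqP => [->|_].
  rewrite /B -(gram_tr_diag I D _ (fun w => (D.+1 - fdeg w)%:R)).
  apply: ex_intro2 erefl; apply: posdefmx_diag => u; rewrite mxE ltr0n subn_gt0.
  by have := wvec_words u; rewrite mem_words ltnS => /andP[].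
apply: gram_interiorZ e0 _; apply: ex_intro2 erefl; exact: posdefmx1.
Qed.

End Interior.

(** * Constant trace *)

Section Riesz.
Variables (R : realType) (n : nat) (y : word n -> R).
Implicit Types (I : {set 'I_n}) (q p : ncpoly R n).

Lemma rieszE (d : {fset word n}) q : (msupp q `<=` d)%fset ->
  riesz y q = \sum_(w <- d) q@_w * y w.
Proof. exact: (mmapEw (f := idfun)). Qed.

Lemma riesz_sum (T : Type) (r : seq T) (P : pred T) (F : T -> ncpoly R n) :
  riesz y (\sum_(t <- r | P t) F t) = \sum_(t <- r | P t) riesz y (F t).
Proof.
exact: (raddf_sum (mmap idfun y : {additive ncpoly R n -> R})).
Qed.

Lemma rieszZ c q : riesz y (c *: q) = c * riesz y q.
Proof.
rewrite (rieszE (msuppZ_le _ _)) mulr_sumr; apply: eq_bigr => w _.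
by rewrite mcoeffZ mulrA.
Qed.

Lemma riesz1 : riesz y 1 = y mone.
Proof. by rewrite /riesz msuppU1 big_seq_fset1 mcoeffUU mul1r. Qed.

End Riesz.

(** G' is G with both indices moved by the involution of words, which turns the
    pairing of G(u,v) with v q u^* into the one with u^* q v. *)
Lemma riesz_gram_tr (R : realType) (n : nat) (I : {set 'I_n}) d
    (q : ncpoly R n) (G : 'M[R]_(nwords d #|I|)) :
  posdefmx G -> exists2 G', posdefmx G' & forall y : word n -> R,
    riesz y (gram_tr q G) = \tr (G' *m loc_mx I y d q).
Proof.
move=> Gpos.
have /fin_all_exists[s sP] (u : 'I_(nwords d #|I|)) :
    exists u', wvec I d u' = wstar (wvec I d u).
  by apply: wordsP; rewrite wstar_words wvec_words.
have sK : involutive s.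
  by move=> u; apply: (@wvec_inj _ I d); rewrite !sP wstarK.
exists (mxsub s s G) => [|y]; first exact: posdefmx_reindex.
rewrite /gram_tr riesz_sum /mxtrace (reindex_inj (inv_inj sK)) /=.
apply: eq_bigr => u _; rewrite riesz_sum mxE (reindex_inj (inv_inj sK)) /=.
by apply: eq_bigr => v _; rewrite rieszZ !mxE !sP wstarK.
Qed.

Lemma mul_mxdiag (R : pzSemiRingType) (q : nat) (s : 'I_q -> nat)
    (A B : forall a, 'M[R]_(s a)) :
  (\mxdiag_(a < q) A a) *m (\mxdiag_(a < q) B a) = \mxdiag_(a < q) (A a *m B a).
Proof.
rewrite {2}/mxdiag mul_mxdiag_mxblock; apply/eq_mxblock => i j.
by case: eqP => [ij|_]; [case: _ / ij; rewrite !conform_mx_id | rewrite mulmx0].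
Qed.

(** P consists of the square roots of the reindexed Gram matrices, and
    Tr(P D P) = Tr(P P D). *)
Lemma Qint_constant_trace (R : realType) (n m : nat) (I : {set 'I_n})
    (g : 'I_m.+1 -> ncpoly R n) (J : {set 'I_m.+1}) k q :
  Qint I g J k q -> exists2 P : 'M[R]_(\sum_a blk_size I g J k a),
    in_Spp P & forall y, \tr (P *m Dmx I g J k y *m P) = riesz y q.
Proof.
move=> [G [Gpos ->]].
have /fin_all_exists[Y YP] (a : 'I_#|ord0 |: J|) :
    exists Y : 'M[R]_(blk_size I g J k a), posdefmx Y /\
    forall y, \tr (Y *m Y *m loc_mx I y (k - hdeg (g (blk a))) (g (blk a))) =
      riesz y (gram_tr (g (blk a)) (G (blk a))).
  have [H Hpos HG] := riesz_gram_tr (g (blk a)) (Gpos _ (enum_valP a)).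
  have [Y Ypos YH] := posdefmx_sqrt Hpos; exists Y; split=> // y.
  by rewrite YH HG.
exists (\mxdiag_(a < #|ord0 |: J|) Y a).
  split; first by exists Y; split=> // a; have [[]] := YP a.
  by apply: posdefmx_mxdiag => a; case: (YP a).
move=> y; rewrite mxtrace_mulC mulmxA /Dmx !mul_mxdiag mxtrace_mxdiag riesz_sum.
rewrite [RHS]big_enum_val; apply: eq_bigr => a _.
by case: (YP a) => _ ->.
Qed.

Theorem theorem4p2 (R : realType) (n m l p : nat) (f : ncpoly R n)
  (g : 'I_m.+1 -> ncpoly R n) (h : 'I_l -> ncpoly R n)
  (I : 'I_p -> {set 'I_n}) (J : 'I_p -> {set 'I_m.+1})
  (W : 'I_p -> {set 'I_l})
  (fsym : ncsym f) (gsym : forall i, ncsym (g i)) (hsym : forall i, ncsym (h i))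
  (g0 : g ord0 = 1)
  (Icliques : csp_cliques (csp_graph f g h) I)
  (Jpart : family_partition J [set~ ord0])
  (Wpart : family_partition W [set: 'I_l])
  (gI : forall j i, i \in J j -> nc_over (I j) (g i))
  (hI : forall j i, i \in W j -> nc_over (I j) (h i))
  (ball : forall j, exists2 i, i \in J j & g i = ball_poly R (I j)) :
  (forall (k : nat) (j : 'I_p) (c : R), (kmin f g h <= k)%N -> 0 < c ->
     Qint (I j) g (J j) k c%:MP) /\
  CSCTP f g h I J W.
Proof.
have J0 j : ord0 \notin J j.
  have : J j \subset [set~ ord0] by rewrite -Jpart.2 bigcup_sup.
  by rewrite subsetC sub1set inE.
have const k j c : (kmin f g h <= k)%N -> 0 < c -> Qint (I j) g (J j) k c%:MP.
  move=> kk c0; have [b bJ gb] := ball j; apply: (Qint_const g0) bJ gb c0 => //.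
  move=> i iJ; split; [exact: gsym | exact: gI |].
  apply: leq_trans kk; rewrite /kmin; do 2 rewrite leq_max; rewrite orbC.
  rewrite leq_bigmax_cond //; by apply: contraNneq (J0 j) => <-.
split=> // k j kk; have [P PS PD] := Qint_constant_trace (const k j 1 kk ltr01).
by exists 1, P; split=> // y _ _ y1; rewrite PD riesz1.
Qed.
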